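(* Let $0<q<1$ and let $\mu$ be a positive Borel measure on $(0,\infty)$ such that $m_n:=\int_0^\infty x^n\,d\mu(x)<\infty$ for all integers $n\ge -2$. Assume that the operators $T_q\colon D(T_q)\to L^2(\mu)$ and $T_{q^{-1}}\colon D(T_{q^{-1}})\to L^2(\mu)$ have trivial kernels. Then the domain $D(L)$ is dense in $L^2(\mu)$. Moreover, the operator $(L,D(L))$ is symmetric on $L^2(\mu)$ (i.e. $\langle Lf,g\rangle=\langle f,Lg\rangle$ for all $f,g\in D(L)$) if and only if the image measure $\tau_q(\mu)$ is absolutely continuous with respect to $\mu$ with Radon--Nikodym derivative $$\frac{d\tau_q(\mu)}{d\mu}(x)=\frac1x\quad\text{for } \mu\text{-a.e. } x.$$
   Context: For $a>0$, $\tau_a:(0,\infty)\to(0,\infty)$ is the map $x\mapsto ax$, and $\tau_a(\mu)$ is the image measure $\tau_a(\mu)(A)=\mu(\tau_a^{-1}(A))$. $T_a$ is the operator $(T_af)(x)=f(ax)$, considered for $a=q^{\pm1}$ on the maximal domain $D(T_{q^{\pm1}})=\{f\in L^2(\mu)\mid T_{q^{\pm1}}f\in L^2(\mu)\}$. The trivial kernel assumption means: if $f\in D(T_{q^{\pm1}})$ and $f(q^{\pm1}x)=0$ for $\mu$-a.e. $x$, then $f=0$ $\mu$-a.e. Applied to indicator functions, it says that $\mu$ is absolutely continuous with respect to $\tau_{q}(\mu)$ and to $\tau_{q^{-1}}(\mu)$; consequently $T_{q^{\pm1}}$ are well defined on $\mu$-a.e. equivalence classes. $M$ is multiplication by $1/x$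 on the maximal domain $D(M)=\{f\in L^2(\mu)\mid\int_0^\infty x^{-2}|f(x)|^2d\mu(x)<\infty\}$. The operator $L$ is $$(Lf)(x)=f(xq)-\frac1x f(x)+\frac1x f(x/q),$$ i.e. $L=T_q-M+M\circ T_{q^{-1}}$, with domain $$D(L)=\{f\in L^2(\mu)\mid f\in D(T_q)\cap D(M)\cap D(T_{q^{-1}}),\ T_{q^{-1}}f\in D(M)\}.$$ *)

(* Defs.v *)
From HB Require Import structures.
From mathcomp Require Import all_boot all_order all_algebra.
From mathcomp Require Import all_classical all_reals all_analysis.
From mathcomp Require Import measurable_realfun complex.

Set Implicit Arguments.
Unset Strict Implicit.
Unset Printing Implicit Defensive.

Import Order.TTheory GRing.Theory Num.Theory.
Import numFieldNormedType.Exports.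

Local Open Scope classical_set_scope.
Local Open Scope complex_scope.
Local Open Scope ring_scope.

Notation normc := ComplexField.Normc.normc.

(* Borel measures on (0, +oo) are represented by Borel measures on R which
   vanish on ]-oo, 0]; accordingly the elements of L^2((0, +oo), mu) are
   represented by functions R -> R[i], whose values on ]-oo, 0] (in particular
   the junk value 0^-1 = 0) are mu-irrelevant. *)

Section RadonNikodymDerivative.
Context d (T : measurableType d) (R : realType).

Definition has_RN_derivative (nu : set T -> \bar R)
    (mu : {measure set T -> \bar R}) (h : T -> \bar R) : Prop :=
  [/\ nu `<< mu, measurable_fun [set: T] h &
      forall A, measurable A -> nu A = (\int[mu]_(x in A) h x)%E].

End RadonNikodymDerivative.

(* On charges, this is almost everywhere equality with the derivative of the
   library, which is packaged for a charge and a sigma-finite measure. *)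
Lemma has_RN_derivativeE d (T : measurableType d) (R : realType)
    (nu : {charge set T -> \bar R}) (mu : {sigma_finite_measure set T -> \bar R})
    (h : T -> \bar R) : mu.-integrable [set: T] h ->
  has_RN_derivative nu mu h <->
  nu `<< mu /\ ae_eq mu [set: T] (Radon_Nikodym nu mu) h.
Proof.
move=> ih; split=> [[numu mh hE]|[numu nuh]].
  split=> //; apply: integral_ae_eq => //.
  - exact: Radon_Nikodym_integrable.
  - by move=> A _ mA; rewrite -Radon_Nikodym_integral// hE.
have mh := measurable_int _ ih; split=> // A mA.
rewrite (Radon_Nikodym_integral numu mA); apply: ae_eq_integral => //.
- exact/measurable_funTS/(measurable_int mu)/Radon_Nikodym_integrable.
- exact: measurable_funTS.
- exact: ae_eq_subset nuh.
Qed.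

Section Operators.
Context {R : realType}.
Implicit Types (mu : {measure set (measurableTypeR R) -> \bar R}).
Implicit Types (a q : R) (f g : measurableTypeR R -> R[i]).

Definition cmeasurable f : Prop :=
  measurable_fun [set: measurableTypeR R] (fun x => complex.Re (f x)) /\
  measurable_fun [set: measurableTypeR R] (fun x => complex.Im (f x)).

Definition L2 mu : set (measurableTypeR R -> R[i]) :=
  [set f | cmeasurable f /\ finite_norm mu 2%:E (fun x => normc (f x))].

Definition cintegral mu f : R[i] :=
  (\int[mu]_x complex.Re (f x)) +i* (\int[mu]_x complex.Im (f x)).

Definition inner mu f g : R[i] := cintegral mu (fun x => f x * (g x)^*).

Definition L2_dense mu (D : set (measurableTypeR R -> R[i])) : Prop :=
  D `<=` L2 mu /\
  forall f, L2 mu f -> forall e : R, 0 < e ->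
    exists2 g, D g & (Lnorm mu 2%:E (fun x => (normc (f x - g x))%:E) < e%:E)%E.

Definition symmetric_op mu (D : set (measurableTypeR R -> R[i]))
    (A : (measurableTypeR R -> R[i]) -> (measurableTypeR R -> R[i])) : Prop :=
  forall f g, D f -> D g -> inner mu (A f) g = inner mu f (A g).

Definition tau a (x : measurableTypeR R) : measurableTypeR R := a * x.

Definition T_op a f : measurableTypeR R -> R[i] := fun x => f (a * x).

Definition T_dom mu a : set (measurableTypeR R -> R[i]) :=
  [set f | L2 mu f /\ L2 mu (T_op a f)].

Definition T_trivial_kernel mu a : Prop :=
  forall f, T_dom mu a f ->
    {ae mu, forall x, T_op a f x = 0} -> {ae mu, forall x, f x = 0}.

Definition M_op f : measurableTypeR R -> R[i] := fun x => (x^-1)%:C * f x.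

Definition M_dom mu : set (measurableTypeR R -> R[i]) :=
  [set f | L2 mu f /\
    (\int[mu]_(x in `]0%R, +oo[) (x ^- 2 * normc (f x) ^+ 2)%:E < +oo)%E].

Definition L_op q f : measurableTypeR R -> R[i] :=
  fun x => T_op q f x - M_op f x + M_op (T_op q^-1 f) x.

Definition L_dom mu q : set (measurableTypeR R -> R[i]) :=
  [set f | L2 mu f /\
    [/\ T_dom mu q f, M_dom mu f, T_dom mu q^-1 f & M_dom mu (T_op q^-1 f)]].

End Operators.

(* Main.v *)
Require Import Defs.
From HB Require Import structures.
From mathcomp Require Import all_boot all_order all_algebra.
From mathcomp Require Import all_classical all_reals all_analysis.
From mathcomp Require Import measurable_realfun complex.
From mathcomp Require Import ring lra.
Import Order.TTheory GRing.Theory Num.Theory.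
Import numFieldNormedType.Exports.

(** Density. A bounded measurable function stays bounded under dilations, and the
    moments of order 0 and -2 are finite, so every such function belongs to the
    domain of L ([bounded_L_dom]); truncating a square-integrable function
    approximates it by bounded ones ([L_dom_dense]).

    Symmetry. Let nu be the image of mu under x |-> qx. For f, g in the domain,
    the function h(x) = f(x) * conj (g(x/q)) satisfies
      <T_q f, g> = int h(qx) dmu(x) = int h dnu,
      <f, M T_{1/q} g> = int h(x)/x dmu(x).
    If nu has density 1/x, these agree ([inner_T]), so T_q and M o T_{1/q} are
    formally adjoint to each other; since 1/x is real, their sum minus M is
    symmetric ([symmetric_of_RN]).

    Conversely, symmetry of L says that the signed measure rho = nu - mu/x
    satisfies int h drho = int conj k drho, where k(x) = g(x) * conj (f(x/q)).
    For f = 1_B and g = 1_{B/q}, with B contained in an interval ]qr, r[, one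
    gets h = 1_B and k = 0, as qB and B/q are disjoint. Thus rho(B) = 0, and
    countably many intervals ]qr, r[ cover the half-line ([RN_of_symmetric]). *)

Local Open Scope classical_set_scope.
Local Open Scope ring_scope.
Set Implicit Arguments.
Unset Strict Implicit.

(** * Charges, densities and integrals *)

Section MeasureTheory.
Context {d : measure_display} {T : measurableType d} {R : realType}.

(** Cutting a set along the disjoint sequence obtained from the cover reduces
    the equality to pieces on which it is assumed. It turns an identity between
    two measures that is only accessible on small sets into a global one. *)
Lemma eq_semi_sigma_additive_cover {I : countType} {F : I -> set T}
    {m1 m2 : set T -> \bar R} :
    m1 set0 = 0%E -> m2 set0 = 0%E ->
    semi_sigma_additive m1 -> semi_sigma_additive m2 ->
    (forall i, measurable (F i)) -> \bigcup_i F i = [set: T] ->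
    (forall i A, measurable A -> A `<=` F i -> m1 A = m2 A) ->
  forall A, measurable A -> m1 A = m2 A.
Proof.
move=> m10 m20 add1 add2 mF FT eqF A mA.
pose G n := A `&` oapp F set0 (unpickle n).
have mG n : measurable (G n).
  by rewrite /G; case: unpickle => [i|] /=; apply: measurableI.
have mD n : measurable (seqDU G n).
  by apply: measurableD => //; exact: bigsetU_measurable.
have AE : A = \bigcup_n seqDU G n.
  rewrite -seqDU_bigcup_eq; apply/seteqP; split=> [x Ax|x [n _ []//]].
  have [i _ Fix] : (\bigcup_i F i) x by rewrite FT.
  by exists (pickle i) => //; rewrite /G pickleK.
have eqD n : m1 (seqDU G n) = m2 (seqDU G n).
  have: seqDU G n `<=` G n by exact: subset_seqDU.
  rewrite {2}/G; case: (unpickle n) => [i|] /= sub.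
    by apply: (eqF i) => // x /sub[].
  have -> : seqDU G n = set0 by apply/seteqP; split=> // x /sub[].
  by rewrite m10 m20.
have mU : measurable (\bigcup_n seqDU G n) by exact: bigcup_measurable.
have c1 := add1 _ mD (trivIset_seqDU G) mU.
have c2 : (fun n => \sum_(0 <= k < n) m1 (seqDU G k))%E @ \oo -->
    m2 (\bigcup_n seqDU G n).
  under eq_fun do under eq_bigr do rewrite eqD.
  exact: add2 _ mD (trivIset_seqDU G) mU.
by rewrite AE; exact: (cvg_unique _ c1 c2).
Qed.

(** This packages a finiteness proof, so that results on bundled finite measures
    apply to a measure, such as an image measure, whose finiteness is a
    hypothesis. *)
Lemma fin_num_fun_finite_measure {m : {measure set T -> \bar R}} :
  fin_num_fun m -> exists fm : {finite_measure set T -> \bar R}, m = fm.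
Proof.
move=> fin.
have sfin : sigma_finite [set: T] m.
  by apply: fin_num_fun_sigma_finite => //; rewrite measure0.
pose H1 := isFinite.Build _ _ _ (Measure.sort m) fin.
pose H2 := isSFinite.Build _ _ _ (Measure.sort m)
  (sfinite_measure_sigma_finite sfin).
pose H3 := isSigmaFinite.Build _ _ _ (Measure.sort m) sfin.
exists (HB.pack_for (FiniteMeasure.type T R) (Measure.sort m) H1 H2 H3).
exact: eq_measure.
Qed.

(** The density h is a.e. the Radon-Nikodym derivative, for which the change of
    variables formula is known. *)
Lemma has_RN_derivative_integral {nu mu : {measure set T -> \bar R}}
    {h : T -> \bar R} :
    fin_num_fun nu -> fin_num_fun mu ->
    mu.-integrable [set: T] h -> has_RN_derivative nu mu h ->
  forall F, nu.-integrable [set: T] F ->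
  (\int[nu]_x F x = \int[mu]_x (F x * h x))%E.
Proof.
move=> /fin_num_fun_finite_measure[fnu ->] /fin_num_fun_finite_measure[fmu ->].
move=> ih RNh F iF.
have mF := measurable_int _ iF; have mh := measurable_int _ ih.
have [numu nuh] :=
  (has_RN_derivativeE (charge_of_finite_measure fnu) ih).1 RNh.
rewrite -(Radon_Nikodym_change_of_variables numu measurableT iF).
apply: ae_eq_integral => //.
- exact: emeasurable_funM.
- exact: emeasurable_funM.
- exact: ae_eqe_mul2l.
Qed.

Lemma RintegralN (mu : {measure set T -> \bar R}) (f : T -> R) :
    mu.-integrable [set: T] (EFin \o f) ->
  \int[mu]_x (- f x) = - \int[mu]_x f x.
Proof.
move=> intf; rewrite -[RHS]mulN1r -RintegralZl//.
by apply: eq_Rintegral => x _; rewrite mulN1r.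
Qed.

End MeasureTheory.

(** Away from 0 one has x^-1 = x * (x^2)^-1, and x^2 lies in the range where
    inversion is the power function of exponent -1; both sides vanish at 0. *)
Lemma measurable_invr {R : realType} :
  measurable_fun [set: measurableTypeR R] (fun x => x^-1).
Proof.
rewrite (_ : (fun x => x^-1) = (fun x : R => x * ((x ^+ 2) `^ (-1)))).
  apply: measurable_funM => //.
  apply: (measurableT_comp (measurable_powR (-1))) => //.
apply/funext => x; rewrite powR_inv1 ?sqr_ge0//.
have [->|x0] := eqVneq x 0; first by rewrite mul0r invr0.
by field.
Qed.

(** * Measurable complex functions *)

Section ComplexMeasurable.
Context {R : realType}.
Implicit Types (f g : measurableTypeR R -> R[i]).
Local Open Scope complex_scope.
Local Open Scope ring_scope.

Lemma normc_sqrE (z : R[i]) :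
  normc z ^+ 2 = complex.Re z ^+ 2 + complex.Im z ^+ 2.
Proof. by case: z => a b /=; rewrite sqr_sqrtr// addr_ge0 ?sqr_ge0. Qed.

Lemma cmeasurableM f g : cmeasurable f -> cmeasurable g ->
  cmeasurable (fun x => f x * g x).
Proof.
move=> [mfr mfi] [mgr mgi]; split.
- rewrite [X in measurable_fun _ X](_ : _ = (fun x =>
    complex.Re (f x) * complex.Re (g x) - complex.Im (f x) * complex.Im (g x))).
    by apply: measurable_funB; exact: measurable_funM.
  by apply/funext => x; case: (f x); case: (g x).
- rewrite [X in measurable_fun _ X](_ : _ = (fun x =>
    complex.Re (f x) * complex.Im (g x) + complex.Im (f x) * complex.Re (g x))).
    by apply: measurable_funD; exact: measurable_funM.
  by apply/funext => x; case: (f x); case: (g x).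
Qed.

Lemma cmeasurable_conj f : cmeasurable f -> cmeasurable (fun x => (f x)^*).
Proof.
move=> [mfr mfi]; split.
- rewrite [X in measurable_fun _ X](_ : _ = (fun x => complex.Re (f x)))//.
  by apply/funext => x; case: (f x).
- rewrite [X in measurable_fun _ X](_ : _ = (fun x => - complex.Im (f x))).
    exact: measurableT_comp.
  by apply/funext => x; case: (f x).
Qed.

Lemma cmeasurable_real (h : measurableTypeR R -> R) :
  measurable_fun [set: _] h -> cmeasurable (fun x => (h x)%:C).
Proof. by move=> mh; split => //=; exact: measurable_cst. Qed.

Lemma measurable_tau (a : R) : measurable_fun [set: _] (tau a).
Proof. exact: mulrl_measurable. Qed.

Lemma cmeasurable_T (a : R) f : cmeasurable f -> cmeasurable (T_op a f).
Proof.
by move=> [mr mi]; split;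
  [exact: (measurableT_comp mr (measurable_tau a))
  |exact: (measurableT_comp mi (measurable_tau a))].
Qed.

Lemma cmeasurable_M f : cmeasurable f -> cmeasurable (M_op f).
Proof.
by move=> mf; apply: cmeasurableM => //;
  exact: cmeasurable_real measurable_invr.
Qed.

Lemma measurable_normc_sqr f : cmeasurable f ->
  measurable_fun [set: _] (fun x => normc (f x) ^+ 2).
Proof.
move=> [mr mi]; under eq_fun do rewrite normc_sqrE.
by apply: measurable_funD; exact: measurable_funX.
Qed.

Lemma normr_ReM_le (z w : R[i]) :
  `|complex.Re (z * w)| <= normc z ^+ 2 + normc w ^+ 2.
Proof.
rewrite !normc_sqrE ler_norml; case: z w => [a b] [c e] /=.
have := sqr_ge0 (a + c); have := sqr_ge0 (a - c).
have := sqr_ge0 (b + e); have := sqr_ge0 (b - e).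
by move=> *; apply/andP; split; nra.
Qed.

Lemma normr_ImM_le (z w : R[i]) :
  `|complex.Im (z * w)| <= normc z ^+ 2 + normc w ^+ 2.
Proof.
rewrite !normc_sqrE ler_norml; case: z w => [a b] [c e] /=.
have := sqr_ge0 (a + e); have := sqr_ge0 (a - e).
have := sqr_ge0 (b + c); have := sqr_ge0 (b - c).
by move=> *; apply/andP; split; nra.
Qed.

Lemma normc_conj_sqr (z : R[i]) : normc z^* ^+ 2 = normc z ^+ 2.
Proof. by rewrite !normc_sqrE; case: z => a b /=; rewrite sqrrN. Qed.

Lemma normc_M_sqr f x : normc (M_op f x) ^+ 2 = x ^- 2 * normc (f x) ^+ 2.
Proof. by rewrite /M_op !normc_sqrE -exprVn; case: (f x) => a b /=; ring. Qed.

End ComplexMeasurable.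

(** * Square-integrable functions and the inner product *)

Section L2Space.
Context {R : realType} (mu : {measure set (measurableTypeR R) -> \bar R}).
Implicit Types (f g : measurableTypeR R -> R[i]).
Local Open Scope complex_scope.
Local Open Scope ring_scope.

Lemma Lnorm2_normc f : Lnorm mu 2%:E (fun x => (normc (f x))%:E) =
  ((\int[mu]_x (normc (f x) ^+ 2)%:E) `^ 2^-1)%E.
Proof.
rewrite unlock; congr (_ `^ _)%E; apply: eq_integral => x _ /=.
by rewrite powR_mulrn// real_normK// num_real.
Qed.

(** The squared modulus is polynomial in the real and imaginary parts, hence
    easier to handle than the norm by which the space is defined. *)
Lemma L2P f : L2 mu f <-> cmeasurable f /\
  mu.-integrable [set: _] (fun x => (normc (f x) ^+ 2)%:E).
Proof.
rewrite /L2 /finite_norm /=.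
have -> : (EFin \o (fun x => normc (f x))) = (fun x => (normc (f x))%:E) by [].
rewrite Lnorm2_normc; split=> -[mf fin]; split=> //.
- apply/integrableP; split.
    by apply/measurable_EFinP; exact: measurable_normc_sqr.
  under eq_integral do rewrite gee0_abs ?lee_fin ?sqr_ge0//.
  by apply: lty_poweRy fin; rewrite invr_neq0.
- apply: poweR_lty; move/integrableP : fin => [_].
  by under eq_integral do rewrite gee0_abs ?lee_fin ?sqr_ge0//.
Qed.

Definition cintegrable f : Prop :=
  mu.-integrable [set: _] (fun x => (complex.Re (f x))%:E) /\
  mu.-integrable [set: _] (fun x => (complex.Im (f x))%:E).

(** Real and imaginary parts of a product z * w are bounded by |z|^2 + |w|^2,
    which is integrable. *)
Lemma L2_cintegrable f g : L2 mu f -> L2 mu g ->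
  cintegrable (fun x => f x * (g x)^*).
Proof.
move=> /L2P[mf fin] /L2P[mg gin].
have [mr mi] := cmeasurableM mf (cmeasurable_conj mg).
have fgin := integrableD measurableT fin gin.
split; apply: le_integrable fgin => //; try exact/measurable_EFinP.
- move=> x _; rewrite /= lee_fin [leRHS]ger0_norm ?addr_ge0 ?sqr_ge0//.
  by rewrite -(normc_conj_sqr (g x)) normr_ReM_le.
- move=> x _; rewrite /= lee_fin [leRHS]ger0_norm ?addr_ge0 ?sqr_ge0//.
  by rewrite -(normc_conj_sqr (g x)) normr_ImM_le.
Qed.

Lemma cintegrableN f : cintegrable f -> cintegrable (fun x => - f x).
Proof.
move=> [fr fi]; split.
- apply: eq_integrable (integrableN fr) => // x _.
  by rewrite /=; case: (f x).
- apply: eq_integrable (integrableN fi) => // x _.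
  by rewrite /=; case: (f x).
Qed.

Lemma cintegrableD f g : cintegrable f -> cintegrable g ->
  cintegrable (fun x => f x + g x).
Proof.
move=> [fr fi] [gr gi]; split.
- apply: eq_integrable (integrableD _ fr gr) => // x _ /=.
  by case: (f x); case: (g x).
- apply: eq_integrable (integrableD _ fi gi) => // x _ /=.
  by case: (f x); case: (g x).
Qed.

Lemma cintegralD f g : cintegrable f -> cintegrable g ->
  cintegral mu (fun x => f x + g x) = cintegral mu f + cintegral mu g.
Proof.
move=> [fr fi] [gr gi]; rewrite /cintegral; simpc.
rewrite -!RintegralD//; congr (_ +i* _);
  by apply: eq_Rintegral => x _; case: (f x); case: (g x).
Qed.

Lemma cintegralN f : cintegrable f ->
  cintegral mu (fun x => - f x) = - cintegral mu f.
Proof.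
move=> [fr fi]; rewrite /cintegral; simpc.
rewrite -!RintegralN//; congr (_ +i* _);
  by apply: eq_Rintegral => x _; case: (f x).
Qed.

Lemma cintegral_conj f : cintegrable f ->
  cintegral mu (fun x => (f x)^*) = (cintegral mu f)^*.
Proof.
move=> [fr fi]; rewrite /cintegral /=; congr (_ +i* _).
  by apply: eq_Rintegral => x _; case: (f x).
by rewrite -RintegralN//; apply: eq_Rintegral => x _; case: (f x).
Qed.

Lemma inner_conj f g : L2 mu f -> L2 mu g -> inner mu g f = (inner mu f g)^*.
Proof.
move=> Lf Lg; rewrite /inner -cintegral_conj; last exact: L2_cintegrable.
by congr cintegral; apply/funext => x; rewrite rmorphM /= conjCK mulrC.
Qed.

Lemma cintegralBD f g h : cintegrable f -> cintegrable g -> cintegrable h ->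
  cintegral mu (fun x => f x - g x + h x) =
  cintegral mu f - cintegral mu g + cintegral mu h.
Proof.
move=> fi gi hi; rewrite -cintegralN// -cintegralD//; last exact: cintegrableN.
by rewrite -cintegralD//; apply: cintegrableD => //; exact: cintegrableN.
Qed.

End L2Space.

(** * Density of the domain *)

Section HalfLine.
Context {R : realType} {mu : {measure set (measurableTypeR R) -> \bar R}}.
Context (mu_pos : mu `]-oo, 0]%classic = 0%E)
  (moments : forall n : int, -2 <= n ->
    (\int[mu]_(x in `]0%R, +oo[) (x ^ n)%:E < +oo)%E).
Implicit Types (f g : measurableTypeR R -> R[i]).
Local Open Scope complex_scope.
Local Open Scope ring_scope.

Lemma measurable_exprz (n : int) :
  measurable_fun [set: measurableTypeR R] (fun x => x ^ n).
Proof.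
case: n => n; first exact: exprn_measurable.
by apply: (measurableT_comp measurable_invr); exact: exprn_measurable.
Qed.

Lemma ge0_integral_half_line (F : measurableTypeR R -> \bar R) :
    measurable_fun [set: _] F -> (forall x, 0 <= F x)%E ->
  (\int[mu]_x F x = \int[mu]_(x in `]0%R, +oo[) F x)%E.
Proof.
move=> mF F0.
rewrite (ge0_negligible_integral _ _ _ _ mu_pos)//.
by congr (integral _ _ _); rewrite setTD setCitvl.
Qed.

(** The moments are integrals over the half-line of functions which are positive
    there; the complement of the half-line is negligible. The exponents 0, -1
    and -2 give a finite measure, an integrable density x^-1 and the
    square-integrability of x^-1 times a bounded function. *)
Lemma integrable_moment (n : int) : -2 <= n ->
  mu.-integrable [set: _] (fun x => (x ^ n)%:E).
Proof.
move=> n2; have mx : measurable_fun [set: _] (fun x : measurableTypeR R => (x ^ n)%:E).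
  by apply/measurable_EFinP; exact: measurable_exprz.
apply/integrableP; split => //.
rewrite ge0_integral_half_line//; last exact: measurableT_comp.
under eq_integral => x.
  rewrite inE /= in_itv/= andbT => x0; rewrite ger0_norm ?exprz_ge0 ?ltW//.
  over.
exact: moments.
Qed.

Lemma mu_finite : fin_num_fun mu.
Proof.
apply: lty_fin_num_fun; have /integrableP[_] := integrable_moment (n := 0) isT.
by under eq_integral do rewrite expr0z gee0_abs//; rewrite integral_cst// mul1e.
Qed.

Lemma integrable_inv : mu.-integrable [set: _] (fun x => (x^-1)%:E).
Proof. exact: (integrable_moment (n := -1)). Qed.

Lemma M_dom_L2 f : M_dom mu f -> L2 mu (M_op f).
Proof.
move=> [/L2P[mf _] fin]; apply/L2P.
have mMf := cmeasurable_M mf; split=> //.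
have mn : measurable_fun [set: _] (fun x => (normc (M_op f x) ^+ 2)%:E).
  by apply/measurable_EFinP; exact: measurable_normc_sqr.
apply/integrableP; split=> //.
rewrite ge0_integral_half_line//; last exact: measurableT_comp.
apply: le_lt_trans fin; rewrite le_eqVlt; apply/orP; left; apply/eqP.
by apply: eq_integral => x _; rewrite gee0_abs ?lee_fin ?sqr_ge0// normc_M_sqr.
Qed.

Lemma bounded_L2 f (c : R) : cmeasurable f -> (forall x, normc (f x) ^+ 2 <= c) ->
  L2 mu f.
Proof.
move=> mf fc; apply/L2P; split=> //.
apply: le_integrable (integrableZl measurableT c (integrable_moment (n := 0) isT)) => //.
  by apply/measurable_EFinP; exact: measurable_normc_sqr.
move=> x _; rewrite /= lee_fin expr0z mulr1 ger0_norm ?sqr_ge0//.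
exact: le_trans (fc x) (ler_norm _).
Qed.

Lemma bounded_M_dom f (c : R) : cmeasurable f ->
  (forall x, normc (f x) ^+ 2 <= c) -> M_dom mu f.
Proof.
move=> mf fc; split; first exact: (@bounded_L2 _ c).
have c0 : 0 <= c by apply: le_trans (fc 0); exact: sqr_ge0.
have /integrableP[mx2 x2fin] :=
  integrableZl measurableT c (integrable_moment (n := -2) isT).
have mx2' := measurableT_comp (@abse_measurable R setT) mx2.
apply: le_lt_trans x2fin.
apply: (@le_trans _ _ (\int[mu]_(x in `]0%R, +oo[) `|c%:E * (x ^ -2)%:E|)%E).
- apply: ge0_le_integral => //.
  + by move=> x _; rewrite lee_fin mulr_ge0 ?sqr_ge0// invr_ge0 sqr_ge0.
  + apply/measurable_EFinP/measurable_funTS.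
    under eq_fun do rewrite -normc_M_sqr.
    by apply: measurable_normc_sqr; exact: cmeasurable_M.
  + exact: measurable_funTS.
  + move=> x _; rewrite /= lee_fin; apply: (le_trans _ (ler_norm _)).
    by rewrite mulrC ler_wpM2r// invr_ge0 sqr_ge0.
- apply: ge0_subset_integral => //.
Qed.

(** Bounded functions are stable under dilations, and they lie in L^2 and in the
    domain of M because the moments of order 0 and -2 are finite. *)
Lemma bounded_L_dom (q : R) f (c : R) : cmeasurable f ->
  (forall x, normc (f x) ^+ 2 <= c) -> L_dom mu q f.
Proof.
move=> mf fc.
have bT (a : R) : L2 mu (T_op a f).
  by apply: (@bounded_L2 _ c) => [|x]; [exact: cmeasurable_T|exact: fc].
have bf : L2 mu f by exact: (@bounded_L2 _ c).
split=> //; split=> //.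
- exact: (@bounded_M_dom _ c).
- by apply: (@bounded_M_dom _ c) => [|x]; [exact: cmeasurable_T|exact: fc].
Qed.

(** The truncations f * 1_{|f|^2 <= n} are bounded, and the squared distance to f
    is the integral of |f|^2 over {|f|^2 > n}, which tends to 0 by dominated
    convergence. *)
Lemma L_dom_dense (q : R) : L2_dense mu (L_dom mu q).
Proof.
split=> [f [] //|f /L2P[mf fin] e e0].
pose sq x := normc (f x) ^+ 2.
have msq : measurable_fun [set: _] sq by exact: measurable_normc_sqr.
pose small n x := sq x <= n%:R.
have msmall n : measurable_fun [set: _] (small n).
  by apply: measurable_fun_ler.
pose b n x : R := if small n x then 1 else 0.
have mb n : measurable_fun [set: _] (b n).
  by apply: measurable_fun_ifT.
pose g n x := f x * (b n x)%:C.
have mg n : cmeasurable (g n) by apply: cmeasurableM => //; exact: cmeasurable_real.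
have gE n x : normc (g n x) ^+ 2 = sq x * b n x.
  rewrite /g /b /sq !normc_sqrE; case: (f x) (small n x) => u v [] /=; ring.
have gdom n : L_dom mu q (g n).
  apply: (@bounded_L_dom _ _ n%:R) => // x; rewrite gE /b /small.
  by case: ifPn => h; rewrite ?mulr1 ?mulr0.
have dE n x : normc (f x - g n x) ^+ 2 = sq x * (1 - b n x).
  rewrite /g /b /sq !normc_sqrE; case: (f x) (small n x) => u v [] /=; ring.
have cv : (\int[mu]_x (sq x * (1 - b n x))%:E)%E @[n --> \oo] --> 0%E.
  rewrite -(@integral0 _ _ _ mu [set: _]).
  apply: (@dominated_cvg _ _ _ _ _ _ _ _ (EFin \o sq)) => //.
  - move=> n; apply/measurable_EFinP/measurable_funM => //.
    exact: measurable_funB.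
  - move=> x _; apply: cvg_near_cst.
    have := nbhs_infty_ger (sq x); apply: filterS => n /= h.
    by rewrite /b /small h subrr mulr0.
  - move=> n x _ /=; rewrite lee_fin /b; have s0 : 0 <= sq x by exact: sqr_ge0.
    by case: (small n x); rewrite ?subrr ?mulr0 ?subr0 ?mulr1 ?normr0// ger0_norm.
have e2 : (0 < (e ^+ 2)%:E)%E by rewrite lte_fin exprn_gt0.
have [N _ /(_ N (leqnn N)) /= ltN] :=
  cv _ (open_nbhs_nbhs (conj (@open_ereal_lt_ereal R _) e2)).
exists (g N) => //.
rewrite Lnorm2_normc (eq_integral (fun x => (sq x * (1 - b N x))%:E)); last first.
  by move=> x _; rewrite dE.
have I0 : (0 <= \int[mu]_x (sq x * (1 - b N x))%:E)%E.
  by apply: integral_ge0 => x _; rewrite -dE lee_fin sqr_ge0.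
move: I0 ltN; case: (integral _ _ _) => [r| |]//; rewrite !lee_fin !lte_fin => r0 re.
rewrite powR12_sqrt// -[ltRHS](gtr0_norm e0) -sqrtr_sqr.
by rewrite ltr_sqrt// exprn_gt0.
Qed.

End HalfLine.

(** * Symmetry and the image measure *)

Section Symmetry.
Context {R : realType} {mu : {measure set (measurableTypeR R) -> \bar R}}.
Context {q : R} (q_gt0 : 0 < q) (q_lt1 : q < 1).
Context (mu_pos : mu `]-oo, 0]%classic = 0%E)
  (moments : forall n : int, -2 <= n ->
    (\int[mu]_(x in `]0%R, +oo[) (x ^ n)%:E < +oo)%E).
Implicit Types (f g : measurableTypeR R -> R[i]).
Local Open Scope complex_scope.
Local Open Scope ring_scope.

Let nu : {measure set (measurableTypeR R) -> \bar R} :=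
  measure_function_pushforward__canonical__measure_function_Measure mu
    (measurable_tau q).

(** Both sides are the integral of F against the image measure. *)
Lemma integral_dilation (F : measurableTypeR R -> R) :
    has_RN_derivative nu mu (fun x => (x^-1)%:E) ->
    measurable_fun [set: _] F -> mu.-integrable [set: _] (fun x => (F (q * x))%:E) ->
  \int[mu]_x F (q * x) = \int[mu]_x (x^-1 * F x).
Proof.
move=> RN mF iF.
have mt : measurable_fun [set: _] (tau q) := measurable_tau q.
have mEF : measurable_fun [set: _] (EFin \o F) by exact/measurable_EFinP.
have fmu := mu_finite mu_pos moments.
have fnu : fin_num_fun nu.
  move=> A mA; apply: fmu.
  by rewrite -[X in measurable X]setTI; exact: (measurable_tau q).
have iFnu : nu.-integrable [set: _] (EFin \o F).
  exact: (integrable_pushforward mt).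
have := has_RN_derivative_integral (nu := nu) fnu fmu
  (integrable_inv mu_pos moments) RN iFnu.
rewrite (integral_pushforward mt mEF iF measurableT) => eqF.
rewrite /Rintegral; congr fine; apply: etrans eqF _.
by apply: eq_integral => x _; rewrite /= mulrC.
Qed.

Lemma cintegral_dilation f :
    has_RN_derivative nu mu (fun x => (x^-1)%:E) ->
    cmeasurable f -> cintegrable mu (T_op q f) ->
  cintegral mu (T_op q f) = cintegral mu (M_op f).
Proof.
move=> RN [mr mi] [ir ii]; rewrite /cintegral.
rewrite (integral_dilation RN mr ir) (integral_dilation RN mi ii).
by congr (_ +i* _); apply: eq_Rintegral => x _; rewrite /M_op;
  case: (f x) => a b /=; rewrite mul0r ?subr0 ?addr0.
Qed.

Lemma M_op_conj f x : (M_op f x)^* = (x^-1)%:C * (f x)^*.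
Proof. by rewrite /M_op rmorphM; congr (_ * _); exact: conjc_real. Qed.

(** T_q and M o T_{1/q} are formally adjoint: with h(x) = f(x) * conj (g(x/q)),
    the integrand on the left is h(qx), that on the right is h(x)/x. *)
Lemma inner_T f g : has_RN_derivative nu mu (fun x => (x^-1)%:E) ->
    L_dom mu q f -> L_dom mu q g ->
  inner mu (T_op q f) g = inner mu f (M_op (T_op q^-1 g)).
Proof.
move=> RN [Lf [[_ LTf] _ _ _]] [Lg _].
pose h x := f x * (g (q^-1 * x))^*.
have mh : cmeasurable h.
  apply: cmeasurableM; first exact: Lf.1.
  by apply: cmeasurable_conj; apply: cmeasurable_T; exact: Lg.1.
have hq : T_op q h = (fun x => T_op q f x * (g x)^*).
  by apply/funext => x; rewrite /h /T_op mulKf// gt_eqF.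
rewrite /inner -hq cintegral_dilation//; last first.
  by rewrite hq; exact: L2_cintegrable.
by congr cintegral; apply/funext => x; rewrite M_op_conj /h /M_op /T_op; ring.
Qed.

Lemma inner_M f g : inner mu (M_op f) g = inner mu f (M_op g).
Proof.
by rewrite /inner; congr cintegral; apply/funext => x; rewrite M_op_conj /M_op; ring.
Qed.

(** L is the sum of the two formally adjoint operators T_q and M o T_{1/q}, and of
    -M, which is symmetric because 1/x is real. *)
Lemma symmetric_of_RN : has_RN_derivative nu mu (fun x => (x^-1)%:E) ->
  symmetric_op mu (L_dom mu q) (L_op q).
Proof.
move=> RN f g Df Dg.
have MTf_g : inner mu (M_op (T_op q^-1 f)) g = inner mu f (T_op q g).
  case: (Df) (Dg) => [Lf [_ _ _ MTf]] [Lg [[_ LTg] _ _ _]].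
  have LMTf := M_dom_L2 mu_pos MTf.
  by rewrite (inner_conj Lg LMTf) -inner_T// -inner_conj.
case: (Df) (Dg) => [Lf [[_ LTf] Mf _ MTf]] [Lg [[_ LTg] Mg _ MTg]].
have LMf := M_dom_L2 mu_pos Mf; have LMTf := M_dom_L2 mu_pos MTf.
have LMg := M_dom_L2 mu_pos Mg; have LMTg := M_dom_L2 mu_pos MTg.
transitivity (inner mu (T_op q f) g - inner mu (M_op f) g
    + inner mu (M_op (T_op q^-1 f)) g).
  rewrite /inner -cintegralBD; [|exact: L2_cintegrable..].
  by congr cintegral; apply/funext => x; rewrite /L_op; ring.
transitivity (inner mu f (T_op q g) - inner mu f (M_op g)
    + inner mu f (M_op (T_op q^-1 g))).
  by rewrite MTf_g inner_T// inner_M; ring.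
rewrite /inner -cintegralBD; [|exact: L2_cintegrable..].
by congr cintegral; apply/funext => x; rewrite /L_op rmorphD rmorphB /=; ring.
Qed.

(** It suffices to compare the two finite measures on subsets B of ]qr, r[, with
    r rational, and on the negligible half-line. For f = 1_B and g = T_q f the
    sets B, B/q, B/q^2 are disjoint, so that all but one of the terms of
    L f * conj g and of f * conj (L g) vanish; symmetry applied to f and g is then
    the required equality for B. *)
Lemma RN_of_symmetric : symmetric_op mu (L_dom mu q) (L_op q) ->
  has_RN_derivative nu mu (fun x => (x^-1)%:E).
Proof.
move=> sym.
have ih := integrable_inv mu_pos moments.
have mh := measurable_int _ ih.
have mt : measurable_fun [set: _] (tau q) := measurable_tau q.
have mpre A : measurable A -> measurable (tau q @^-1` A).
  by move=> mA; rewrite -[X in measurable X]setTI; exact: mt.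
suff nuE A : measurable A -> nu A = (\int[mu]_(x in A) (x^-1)%:E)%E.
  split=> //; apply/null_content_dominatesP => A mA A0.
  by rewrite nuE// null_set_integral//; exact: measurable_funTS.
pose F (r : option rat) : set (measurableTypeR R) :=
  if r is Some r then `]q * ratr r, ratr r[%classic else `]-oo, 0]%classic.
pose ind := induced_charge ih.
apply: (eq_semi_sigma_additive_cover (F := F) (m2 := ind)).
- exact: (measure0 nu).
- exact: charge0.
- exact: (@measure_semi_sigma_additive _ _ _ nu).
- exact: charge_semi_sigma_additive.
- by case=> [r|]; exact: measurable_itv.
- apply/seteqP; split=> // x _; have [x0|x0] := leP x 0.
    by exists None => //; rewrite /F /= in_itv.
  (* x lies in ]qr, r[ exactly when r lies in ]x, x/q[. *)
  have : x < x / q by rewrite ltr_pdivlMr// gtr_pMr.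
  move=> /rat_in_itvoo[r]; rewrite in_itv /= => /andP[xr rx].
  by exists (Some r) => //; rewrite /F /= in_itv /= xr andbT mulrC -ltr_pdivlMr.
case=> [r|] B mB sub; last first.
  have -> : nu B = 0%E.
    apply: (subset_measure0 (mpre _ mB) _ _ mu_pos) => //.
    by move=> x /sub; rewrite /F /= !in_itv /= /tau pmulr_rle0.
  rewrite /ind /induced_charge null_set_integral//; first exact: measurable_funTS.
  exact: (subset_measure0 mB (measurable_itv _) sub mu_pos).
pose f : measurableTypeR R -> R[i] := fun x => (\1_B x)%:C.
pose g := T_op q f.
have mf : cmeasurable f by apply: cmeasurable_real; exact: measurable_indic.
have mg : cmeasurable g by exact: cmeasurable_T.
have f_le1 x : normc (f x) ^+ 2 <= 1.
  by rewrite normc_sqrE /f indicE; case: (_ \in _) => /=; nra.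
have Df : L_dom mu q f by exact: (bounded_L_dom mu_pos moments q mf f_le1).
have Dg : L_dom mu q g.
  by apply: (bounded_L_dom mu_pos moments q mg) => x; exact: f_le1.
have f1 x : B x -> f x = 1 by move=> Bx; rewrite /f indicE mem_set.
have f0 x : ~ B x -> f x = 0 by move=> Bx; rewrite /f indicE memNset.
have Bq x : B x -> ~ B (q * x).
  move=> /sub + /sub; rewrite /F /= !in_itv /= => /andP[_ xr] /andP[].
  by rewrite ltr_pM2l// => rx _; lra.
have Bqq x : B x -> ~ B (q * (q * x)).
  move=> /sub + /sub; rewrite /F /= !in_itv /= => /andP[qrx xr] /andP[].
  have qxr : q * x < q * ratr r by rewrite ltr_pM2l.
  by rewrite ltr_pM2l// => rqx _; lra.
have LfgE : (fun x => L_op q f x * (g x)^*) = T_op q f.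
  apply/funext => x; rewrite /L_op /M_op /g /T_op.
  have [Bqx|Bqx] := pselect (B (q * x)); last by rewrite (f0 _ Bqx) rmorph0 mulr0.
  rewrite (f1 _ Bqx) (f0 x); last by move/Bq.
  rewrite (f0 (q^-1 * x)) ?rmorph1; first by ring.
  by move/Bqq; rewrite mulVKf// gt_eqF.
have fLgE : (fun x => f x * (L_op q g x)^*) = M_op f.
  apply/funext => x; rewrite /L_op rmorphD rmorphB /= !M_op_conj /M_op /g /T_op.
  rewrite mulVKf ?gt_eqF//.
  have [Bx|Bx] := pselect (B x); last by rewrite (f0 _ Bx) mul0r mulr0.
  rewrite (f1 _ Bx) (f0 _ (Bq _ Bx)) (f0 _ (Bqq _ Bx)) rmorph0 rmorph1.
  by ring.
have := sym f g Df Dg; rewrite /inner LfgE fLgE => -[eqRe _].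
have nuBE : nu B = (\int[mu]_x (complex.Re (T_op q f x))%:E)%E.
  rewrite -[LHS]/(mu (tau q @^-1` B)) -[tau q @^-1` B]setIT.
  by rewrite -integral_indic//; exact: mpre.
have indBE : ind B = (\int[mu]_x (complex.Re (M_op f x))%:E)%E.
  rewrite /ind /induced_charge integral_mkcond; apply: eq_integral => x _.
  rewrite patchE /M_op; case: ifPn => [/set_mem/f1 ->|/negP].
    by rewrite mulr1.
  by rewrite inE => /f0 ->; rewrite mulr0.
have nuBfin : nu B \is a fin_num by apply: (mu_finite mu_pos moments); exact: mpre.
have indBfin : ind B \is a fin_num by exact: fin_num_measure.
rewrite -[LHS](fineK nuBfin) -[RHS](fineK indBfin).
by congr EFin; rewrite nuBE indBE.
Qed.

End Symmetry.

Unset Implicit Arguments.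
Set Strict Implicit.

Theorem proposition2p1 (R : realType) (q : R)
    (mu : {measure set (measurableTypeR R) -> \bar R})
    (q_gt0 : 0 < q) (q_lt1 : q < 1)
    (mu_pos : mu `]-oo, 0]%classic = 0%E)
    (moments : forall n : int, -2 <= n ->
      (\int[mu]_(x in `]0%R, +oo[) (x ^ n)%:E < +oo)%E)
    (kerTq : T_trivial_kernel mu q)
    (kerTqV : T_trivial_kernel mu q^-1) :
  L2_dense mu (L_dom mu q) /\
  (symmetric_op mu (L_dom mu q) (L_op q) <->
   has_RN_derivative (pushforward mu (tau q)) mu (fun x => (x^-1)%:E)).
Proof.
split; first exact: L_dom_dense.
by split; [exact: RN_of_symmetric|exact: symmetric_of_RN].
Qed.
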